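(* Let $D\subsetneq\mathbb{H}^2$ be an open horospherically convex set in the hyperbolic plane. Assume $D$ contains a ball of radius $r>0$. If $F\colon D\to\mathbb{R}$ is a $\theta$-barrier for $D$, then $\theta\ge\frac{1}{2^9}\sqrt r-\frac18$.
   Context: $\mathbb{H}^2$ is the hyperbolic plane: the complete simply connected Riemannian 2-manifold of constant sectional curvature $-1$, with metric $\langle\cdot,\cdot\rangle$ and distance $d$. Balls are open metric balls $B(c,r)=\{p\in\mathbb{H}^2:d(c,p)<r\}$. For a unit-speed geodesic ray $\gamma\colon[0,\infty)\to\mathbb{H}^2$, the Busemann function is $b_\gamma(p)=\lim_{t\to\infty}\big(d(\gamma(t),p)-t\big)$; the associated open horoball is $b_\gamma^{-1}((-\infty,0))$ and the associated closed horoball is its closure $b_\gamma^{-1}((-\infty,0])$. A closed set is horospherically convex if it equals a (possibly uncountable) intersection of closed horoballs. An open horospherically convex set is the interior of a closed horospherically convex set. A set $D\subseteq \mathbb{H}^2$ is geodesically convex (g-convex) if for all $p,q\in D$ the geodesic segment from $p$ to $q$ lies in $D$; horospherically convex sets are g-convex. Barriers. Let $D\subseteq\mathbb{H}^2$ be open and g-convex. For a three times continuously differentiable $F\colon D\to\mathbb{R}$, let $\nabla F(p)\in T_p\mathbb{H}^2$ be the Riemannian gradient, $(\nabla^2F)_p$ the Riemannian Hessian (a symmetric bilinear form on $T_p\mathbb{H}^2$), and $(\nabla^3F)_p$ the third covariant derivative, i.e. the covariant derivative of the Hessian (a trilinear form, in general not symmetric). $F$ is strongly $1$-self-concordant if for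 all $p\in D$ and $u,v,w\in T_p\mathbb{H}^2$, $$|(\nabla^3F)_p(u,v,w)|\le 2\sqrt{(\nabla^2F)_p(u,u)}\sqrt{(\nabla^2F)_p(v,v)}\sqrt{(\nabla^2F)_p(w,w)},$$ and the epigraph $\{(p,t): p\in D,\ t\ge F(p)\}$ is a closed subset of $\mathbb{H}^2\times\mathbb{R}$. For a finite real number $\theta\ge 0$, $F$ is a $\theta$-barrier for $D$ if it is strongly $1$-self-concordant, $(\nabla^2F)_p\succ0$ for all $p\in D$, and $\max_{0\neq v\in T_p\mathbb{H}^2}\frac{\langle\nabla F(p),v\rangle}{\sqrt{(\nabla^2F)_p(v,v)}}\le\sqrt\theta$ for all $p\in D$. *)

(* Defs.v *)
From Stdlib Require Import Reals Lra Psatz.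
From Coquelicot Require Import Coquelicot.
Open Scope R_scope.

(** * The hyperbolic plane: upper half-plane with the metric (dx^2 + dy^2) / y^2 *)

Record H2 : Type := mkH2 { px : R; py : R; py_pos : 0 < py }.

Definition toC (p : H2) : C := (px p, py p).

(* Riemannian distance of (dx^2 + dy^2) / y^2, in closed form:
   sinh (d/2) = |p - q| / (2 sqrt (Im p * Im q)). *)
Definition hdist (p q : H2) : R :=
  2 * arcsinh (Cmod (toC p - toC q)%C / (2 * sqrt (py p * py q))).

Lemma hdist_refl (p : H2) : hdist p p = 0.
Proof.
unfold hdist.
replace (toC p - toC p)%C with (0 : C)%C by ring.
rewrite Cmod_0; unfold Rdiv; rewrite Rmult_0_l, arcsinh_0; ring.
Qed.

Lemma hdist_sym (p q : H2) : hdist p q = hdist q p.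
Proof.
unfold hdist; rewrite (Rmult_comm (py p)), <- (Cmod_opp (toC p - toC q)).
now replace (- (toC p - toC q))%C with (toC q - toC p)%C by ring.
Qed.

Lemma sinh_add (a b : R) : sinh (a + b) = sinh a * cosh b + cosh a * sinh b.
Proof.
unfold sinh, cosh; rewrite Ropp_plus_distr, !exp_plus; field.
Qed.

Lemma cosh_arcsinh (x : R) : cosh (arcsinh x) = sqrt (1 + x ^ 2).
Proof.
assert (Hc : 0 <= cosh (arcsinh x)).
{ unfold cosh; generalize (exp_pos (arcsinh x)) (exp_pos (- arcsinh x)); lra. }
rewrite <- (sqrt_pow2 _ Hc); f_equal.
rewrite <- (sinh_arcsinh x) at 2.
unfold sinh, cosh.
assert (He : exp (arcsinh x) * exp (- arcsinh x) = 1).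
{ rewrite <- exp_plus, Rplus_opp_r; apply exp_0. }
nra.
Qed.

Lemma half_sqrt_pos (p q : H2) : 0 < 2 * sqrt (py p * py q).
Proof.
generalize (sqrt_lt_R0 _ (Rmult_lt_0_compat _ _ (py_pos p) (py_pos q))); lra.
Qed.

Lemma cosh_half_hdist (p q : H2) :
  sqrt (1 + (Cmod (toC p - toC q)%C / (2 * sqrt (py p * py q))) ^ 2)
  = Cmod (toC p - Cconj (toC q))%C / (2 * sqrt (py p * py q)).
Proof.
generalize (half_sqrt_pos p q); intros Hs.
assert (Hpos : 0 <= Cmod (toC p - Cconj (toC q))%C / (2 * sqrt (py p * py q))).
{ apply Rdiv_le_0_compat; [apply Cmod_ge_0 | exact Hs]. }
rewrite <- (sqrt_pow2 _ Hpos); f_equal.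
assert (Hs2 : (2 * sqrt (py p * py q)) ^ 2 = 4 * (py p * py q)).
{ rewrite Rpow_mult_distr, pow2_sqrt; [ring|].
  generalize (py_pos p) (py_pos q); nra. }
assert (H1 : forall a b : R, 0 < b -> (a / b) ^ 2 = a ^ 2 / b ^ 2).
{ intros; field; lra. }
rewrite !H1, Hs2 by exact Hs.
unfold Cmod; rewrite !pow2_sqrt by (apply Rplus_le_le_0_compat; apply pow2_ge_0).
generalize (py_pos p) (py_pos q); simpl; intros; field; lra.
Qed.

(* Ptolemy's inequality for p, q, r and the conjugate of q. *)
Lemma hdist_triangle (p q r : H2) : hdist p r <= hdist p q + hdist q r.
Proof.
unfold hdist.
set (a := Cmod (toC p - toC q)%C / _); set (b := Cmod (toC q - toC r)%C / _).
set (c := Cmod (toC p - toC r)%C / _).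
enough (c <= sinh (arcsinh a + arcsinh b)) as Hc.
{ apply arcsinh_le in Hc; rewrite arcsinh_sinh in Hc; lra. }
rewrite sinh_add, !cosh_arcsinh, !sinh_arcsinh.
unfold a, b, c; rewrite !cosh_half_hdist.
assert (Hpt : Cmod (toC p - toC r)%C * (2 * py q)
   <= Cmod (toC p - toC q)%C * Cmod (toC q - Cconj (toC r))%C
      + Cmod (toC p - Cconj (toC q))%C * Cmod (toC q - toC r)%C).
{ replace (Cmod (toC q - Cconj (toC r))%C)
    with (Cmod (toC r - Cconj (toC q))%C)
    by (unfold Cmod; f_equal; simpl; ring).
  replace (2 * py q) with (Cmod (toC q - Cconj (toC q))%C).
  - rewrite <- !Cmod_mult.
    replace ((toC p - toC r) * (toC q - Cconj (toC q)))%C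
      with ((toC p - toC q) * (toC r - Cconj (toC q))
            + (toC p - Cconj (toC q)) * (toC q - toC r))%C by ring.
    apply Cmod_triangle.
  - unfold Cmod; simpl.
    rewrite <- (sqrt_pow2 (2 * py q)) by (generalize (py_pos q); lra).
    f_equal; ring. }
rewrite !sqrt_mult by (apply Rlt_le, py_pos).
generalize (sqrt_lt_R0 _ (py_pos p)) (sqrt_lt_R0 _ (py_pos q))
  (sqrt_lt_R0 _ (py_pos r)); intros Hp Hq Hr.
rewrite <- (pow2_sqrt (py q)) in Hpt by (apply Rlt_le, py_pos).
set (sp := sqrt (py p)) in *; set (sq := sqrt (py q)) in *.
set (sr := sqrt (py r)) in *.
apply (Rmult_le_reg_r (4 * (sp * sq ^ 2 * sr))).
{ assert (0 < sp * sq ^ 2 * sr)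
    by (apply Rmult_lt_0_compat; [apply Rmult_lt_0_compat; [|apply pow_lt]|]; assumption).
  lra. }
match goal with |- ?L <= ?M =>
  replace L with (Cmod (toC p - toC r)%C * (2 * sq ^ 2)) by (field; lra);
  replace M with (Cmod (toC p - toC q)%C * Cmod (toC q - Cconj (toC r))%C
      + Cmod (toC p - Cconj (toC q))%C * Cmod (toC q - toC r)%C) by (field; lra)
end.
exact Hpt.
Qed.

Lemma hball_center (p : H2) (e : posreal) : hdist p p < e.
Proof. rewrite hdist_refl; apply cond_pos. Qed.

Lemma hball_sym (p q : H2) (e : R) : hdist p q < e -> hdist q p < e.
Proof. now rewrite hdist_sym. Qed.

Lemma hball_triangle (p q r : H2) (e1 e2 : R) :
  hdist p q < e1 -> hdist q r < e2 -> hdist p r < e1 + e2.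
Proof. intros; generalize (hdist_triangle p q r); lra. Qed.

(* [ball c r] is the open metric ball; [open], [closed], [locally] and
   [continuous] on [H2] refer to the topology of [hdist]. *)
Definition H2_UniformSpace_mixin : UniformSpace.mixin_of H2 :=
  UniformSpace.Mixin H2 (mkH2 0 1 Rlt_0_1) (fun c r p => hdist c p < r)
    hball_center hball_sym hball_triangle.

Canonical H2_UniformSpace : UniformSpace :=
  UniformSpace.Pack H2 H2_UniformSpace_mixin H2.

Definition interior (A : H2 -> Prop) (p : H2) : Prop := locally p A.

(** * Tensor calculus in the coordinates (x, y) *)

Inductive axis : Set := ax_x | ax_y.

Definition axis_eqb (i j : axis) : bool :=
  match i, j with
  | ax_x, ax_x | ax_y, ax_y => true
  | _, _ => false
  end.

Definition sum_axis (a : axis -> R) : R := a ax_x + a ax_y.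

(* Components in the coordinate basis of the tangent space. *)
Definition tangent : Type := axis -> R.

Definition coord (k : axis) (p : H2) : R :=
  match k with ax_x => px p | ax_y => py p end.

(* F read in coordinates; the value for y <= 0 is irrelevant, since F is only
   differentiated at points with y > 0. *)
Definition in_chart (F : H2 -> R) (x y : R) : R :=
  match Rlt_dec 0 y with
  | left Hy => F (mkH2 x y Hy)
  | right _ => 0
  end.

Definition slice (i : axis) (F : H2 -> R) (p : H2) : R -> R :=
  match i with
  | ax_x => fun x => in_chart F x (py p)
  | ax_y => fun y => in_chart F (px p) y
  end.

Definition ex_partial (i : axis) (F : H2 -> R) (p : H2) : Prop :=
  ex_derive (slice i F p) (coord i p).

Definition partial (i : axis) (F : H2 -> R) (p : H2) : R :=
  Derive (slice i F p) (coord i p).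

Fixpoint C_on (n : nat) (D : H2 -> Prop) (F : H2 -> R) : Prop :=
  (forall p, D p -> continuous F p) /\
  match n with
  | O => True
  | S m => forall i, (forall p, D p -> ex_partial i F p) /\ C_on m D (partial i F)
  end.

Definition metric (i j : axis) (p : H2) : R :=
  if axis_eqb i j then / (py p) ^ 2 else 0.

Definition metric_inv (i j : axis) (p : H2) : R :=
  if axis_eqb i j then (py p) ^ 2 else 0.

Definition inner (p : H2) (u v : tangent) : R :=
  sum_axis (fun i => sum_axis (fun j => metric i j p * u i * v j)).

(* Christoffel symbols Gamma^k_{ij} of the Levi-Civita connection. *)
Definition Christoffel (k i j : axis) (p : H2) : R :=
  / 2 * sum_axis (fun l => metric_inv k l p *
    (partial i (metric j l) p + partial j (metric i l) p - partial l (metric i j) p)).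

Definition grad (F : H2 -> R) (p : H2) : tangent :=
  fun k => sum_axis (fun l => metric_inv k l p * partial l F p).

Definition hess_comp (F : H2 -> R) (i j : axis) (p : H2) : R :=
  partial i (partial j F) p
  - sum_axis (fun k => Christoffel k i j p * partial k F p).

(* (nabla_l (nabla^2 F))_{ij} *)
Definition third_comp (F : H2 -> R) (l i j : axis) (p : H2) : R :=
  partial l (hess_comp F i j) p
  - sum_axis (fun k => Christoffel k l i p * hess_comp F k j p)
  - sum_axis (fun k => Christoffel k l j p * hess_comp F i k p).

Definition hess (F : H2 -> R) (p : H2) (u v : tangent) : R :=
  sum_axis (fun i => sum_axis (fun j => hess_comp F i j p * u i * v j)).

Definition third (F : H2 -> R) (p : H2) (u v w : tangent) : R :=
  sum_axis (fun l => sum_axis (fun i => sum_axis (fun j =>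
    third_comp F l i j p * u l * v i * w j))).

Definition nonzero (v : tangent) : Prop := exists i, v i <> 0.

(** * Geodesic rays and horoballs *)

(* Unit-speed solution of the geodesic equation on [0, +oo), with velocity V.
   Only t >= 0 matters: the derivatives at t = 0 are two-sided, but a geodesic
   ray always extends to negative times. *)
Definition geodesic_ray (gamma : R -> H2) : Prop :=
  exists V : R -> tangent, forall t, 0 <= t ->
    inner (gamma t) (V t) (V t) = 1 /\
    forall k,
      is_derive (fun s => coord k (gamma s)) t (V t k) /\
      is_derive (fun s => V s k) t
        (- sum_axis (fun i => sum_axis (fun j =>
             Christoffel k i j (gamma t) * V t i * V t j))).

Definition busemann (gamma : R -> H2) (p : H2) : R :=
  real (Lim (fun t => hdist (gamma t) p - t) p_infty).

Definition closed_horoball (gamma : R -> H2) (p : H2) : Prop :=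
  busemann gamma p <= 0.

Definition closed_horo_convex (A : H2 -> Prop) : Prop :=
  closed A /\
  exists S : (R -> H2) -> Prop,
    (forall gamma, S gamma -> geodesic_ray gamma) /\
    (forall p, A p <-> forall gamma, S gamma -> closed_horoball gamma p).

Definition open_horo_convex (D : H2 -> Prop) : Prop :=
  exists A, closed_horo_convex A /\ forall p, D p <-> interior A p.

(** * Barriers *)

(* A function D -> R is represented by a total F : H2 -> R. As D is open, all
   the conditions below depend only on the values of F on D. *)
Definition strongly_self_concordant (D : H2 -> Prop) (F : H2 -> R) : Prop :=
  C_on 3 D F /\
  (forall p, D p -> forall u v w : tangent,
     Rabs (third F p u v w)
     <= 2 * sqrt (hess F p u u) * sqrt (hess F p v v) * sqrt (hess F p w w)) /\
  closed (fun pt : H2 * R => D (fst pt) /\ F (fst pt) <= snd pt).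

Definition barrier (theta : R) (D : H2 -> Prop) (F : H2 -> R) : Prop :=
  0 <= theta /\
  strongly_self_concordant D F /\
  (forall p, D p -> forall v : tangent, nonzero v -> 0 < hess F p v v) /\
  (forall p, D p -> forall v : tangent, nonzero v ->
     inner p (grad F p) v / sqrt (hess F p v v) <= sqrt theta).

(* Main.v *)
Require Import Defs.
From Stdlib Require Import Reals Lra Psatz Classical.
From Coquelicot Require Import Coquelicot.
Open Scope R_scope.

(* Along unit-speed geodesics, F is a one-dimensional self-concordant function,
   so the classical theory applies.  Let rho >= r be the radius of the largest
   ball around c contained in D.  A geodesic from c leaves D within distance
   rho + 1, so by the Dikin bound the Hessian in its direction is at least
   (rho + 1)^-2, and self-concordance produces a point q at distance at most
   (rho + 1) / 2 from c where the slope along the geodesic is at least 1/6 of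
   its Hessian norm.  As the curvature is -1, commuting the first two arguments
   of the third covariant derivative costs a term of size |grad F|; both orders
   being bounded by self-concordance, F_1 <= 4 sqrt(F_11) F_22 in every
   orthonormal frame.  Hence F_22 >= 1/24 at q in the orthogonal direction.  Along that
   direction F still has room (rho - 1) / 2 inside D, while the barrier
   inequality psi'^2 <= theta psi'' makes psi blow up within time O(theta).
   This gives a bound linear in r, which implies the theorem because its right
   side is at most 0 for r <= 4096. *)

(** * Charts and partial derivatives *)

Lemma sinh_pos (x : R) : 0 < x -> 0 < sinh x.
Proof. intros Hx; rewrite <- sinh_0; apply sinh_lt, Hx. Qed.

Lemma H2_ext (p q : H2) : px p = px q -> py p = py q -> p = q.
Proof.
destruct p as [x y Hy], q as [x' y' Hy']; simpl; intros -> ->.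
f_equal; apply proof_irrelevance.
Qed.

Lemma in_chart_mkH2 (G : H2 -> R) (x y : R) (Hy : 0 < y) :
  in_chart G x y = G (mkH2 x y Hy).
Proof.
unfold in_chart; destruct (Rlt_dec 0 y) as [H | H]; [|tauto].
f_equal; now apply H2_ext.
Qed.

Lemma in_chart_coord (G : H2 -> R) (p : H2) : in_chart G (px p) (py p) = G p.
Proof. now destruct p as [x y Hy]; apply in_chart_mkH2. Qed.

Lemma hdist_lt (p q : H2) (e : R) :
  Cmod (toC p - toC q)%C / (2 * sqrt (py p * py q)) < sinh (e / 2) ->
  hdist p q < e.
Proof.
intros H; apply arcsinh_lt in H; rewrite arcsinh_sinh in H.
unfold hdist; lra.
Qed.

(** Every hyperbolic ball contains a coordinate box around its center. This turns openness of [D]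
    and continuity on [H2] into statements about two real variables. *)
Lemma locally_chart (P : H2 -> Prop) (p : H2) :
  locally p P ->
  locally_2d (fun x y => exists Hy : 0 < y, P (mkH2 x y Hy)) (px p) (py p).
Proof.
intros [e He].
assert (Hs : 0 < sinh (e / 2)) by (apply sinh_pos; generalize (cond_pos e); lra).
assert (Hp := py_pos p).
(* The first bound keeps y above [py p / 2], so the denominator [2 * sqrt (py p * y)] exceeds
   [py p]; the second keeps the numerator below [py p * sinh (e / 2)]. *)
assert (Hd : 0 < Rmin (py p / 2) (py p * sinh (e / 2) / 2)).
{ apply Rmin_pos; [lra|]. assert (H := Rmult_lt_0_compat _ _ Hp Hs); lra. }
exists (mkposreal _ Hd); simpl; intros x y Hx Hy.
assert (H1 := Rmin_l (py p / 2) (py p * sinh (e / 2) / 2)).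
assert (H2 := Rmin_r (py p / 2) (py p * sinh (e / 2) / 2)).
set (d := Rmin _ _) in *.
assert (Hy' : py p / 2 < y) by (apply Rabs_def2 in Hy; lra).
assert (Hy0 : 0 < y) by lra.
exists Hy0; apply He.
apply (hdist_lt p (mkH2 x y Hy0) e); unfold toC; simpl.
assert (Hsq : py p / 2 < sqrt (py p * y)).
{ rewrite <- (sqrt_pow2 (py p / 2)) by lra; apply sqrt_lt_1_alt; nra. }
apply Rlt_div_l; [lra|].
apply Rle_lt_trans with (2 * d); [|nra].
refine (Rle_trans _ _ _ (Cmod_2Rmax _) _); simpl.
apply Rmult_le_compat.
- apply sqrt_pos.
- eapply Rle_trans, Rmax_l; apply Rabs_pos.
- apply Rlt_le, sqrt_less; lra.
- apply Rlt_le, Rmax_lub_lt; rewrite Rabs_minus_sym in Hx, Hy; assumption.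
Qed.

Lemma C_on_le (n : nat) (D : H2 -> Prop) (G : H2 -> R) :
  C_on (S n) D G -> C_on n D G.
Proof.
revert G; induction n as [|n IH]; intros G [Hc Hi]; split; auto.
intros i; destruct (Hi i); split; auto.
Qed.

Section Chart.

Variable D : H2 -> Prop.
Hypothesis D_open : open D.

(** An x-derivative that exists near the point and is continuous there, together with a y-derivative
    at the point, gives total differentiability. *)
Lemma differentiable_in_chart (G : H2 -> R) (p : H2) : C_on 1 D G -> D p ->
  differentiable_pt_lim (in_chart G) (px p) (py p) (partial ax_x G p) (partial ax_y G p).
Proof.
intros [_ H1] Dp.
destruct (H1 ax_x) as [Hx [Cx _]], (H1 ax_y) as [Hy _].
apply filterdiff_differentiable_pt_lim.
apply (is_derive_filterdiff (in_chart G) (px p) (py p)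
  (fun u v => Derive (fun z => in_chart G z v) u)).
- apply (locally_2d_locally
    (fun u v => is_derive (fun z => in_chart G z v) u (Derive (fun z => in_chart G z v) u))).
  generalize (locally_chart _ _ (D_open p Dp)).
  apply locally_2d_impl, locally_2d_forall; intros x y [Hy0 Dq].
  exact (Derive_correct _ _ (Hx _ Dq)).
- exact (Derive_correct _ _ (Hy _ Dp)).
- apply (continuity_2d_pt_filterlim (fun u v => Derive (fun z => in_chart G z v) u)).
  intros e.
  generalize (locally_chart _ _
    (Cx p Dp (fun z => Rabs (z - partial ax_x G p) < e) (locally_ball _ e))).
  apply locally_2d_impl, locally_2d_forall; intros x y [Hy0 H]; exact H.
Qed.

Lemma is_derive_along (G : H2 -> R) (gamma : R -> H2) (t dx dy : R) :
  C_on 1 D G -> D (gamma t) ->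
  is_derive (fun s => px (gamma s)) t dx -> is_derive (fun s => py (gamma s)) t dy ->
  is_derive (fun s => G (gamma s)) t
    (partial ax_x G (gamma t) * dx + partial ax_y G (gamma t) * dy).
Proof.
intros HG Dt Hx Hy.
apply (is_derive_ext (fun s => in_chart G (px (gamma s)) (py (gamma s)))).
- intros s; apply in_chart_coord.
- apply is_derive_Reals, derivable_pt_lim_comp_2d;
    [now apply differentiable_in_chart | now apply is_derive_Reals ..].
Qed.

Lemma in_chart_partial_y (G : H2 -> R) (v z : R) : 0 < v ->
  in_chart (partial ax_y G) z v = Derive (fun t => in_chart G z t) v.
Proof. now intros Hv; rewrite (in_chart_mkH2 _ _ _ Hv). Qed.

Lemma in_chart_partial_x (G : H2 -> R) (u v : R) : 0 < v ->
  locally v (fun z => in_chart (partial ax_x G) u z = Derive (fun t => in_chart G t z) u).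
Proof.
intros Hv; apply (locally_open (fun z => 0 < z)); [apply open_gt | | exact Hv].
now intros z Hz; rewrite (in_chart_mkH2 _ _ _ Hz).
Qed.

Lemma partial_comm (G : H2 -> R) (p : H2) : C_on 2 D G -> D p ->
  partial ax_x (partial ax_y G) p = partial ax_y (partial ax_x G) p.
Proof.
intros [_ H2] Dp.
destruct (H2 ax_x) as [Ex [_ Hx]], (H2 ax_y) as [Ey [_ Hy]].
destruct (Hx ax_y) as [Exy [Cxy _]], (Hy ax_x) as [Eyx [Cyx _]].
assert (Hl := locally_chart _ _ (D_open p Dp)).
assert (Pxy : forall u v (Hv : 0 < v), partial ax_x (partial ax_y G) (mkH2 u v Hv)
   = Derive (fun z => Derive (fun t => in_chart G z t) v) u).
{ intros u v Hv; apply Derive_ext; intros z; now apply in_chart_partial_y. }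
assert (Pyx : forall u v (Hv : 0 < v), partial ax_y (partial ax_x G) (mkH2 u v Hv)
   = Derive (fun z => Derive (fun t => in_chart G t z) u) v).
{ intros u v Hv; apply Derive_ext_loc; now apply in_chart_partial_x. }
replace p with (mkH2 (px p) (py p) (py_pos p)) by now apply H2_ext.
rewrite Pxy, Pyx; apply Schwarz.
- revert Hl; apply locally_2d_impl, locally_2d_forall; intros u v [Hv Dq].
  repeat split.
  + exact (Ex _ Dq).
  + exact (Ey _ Dq).
  + refine (ex_derive_ext _ _ _ _ (Eyx _ Dq)); intros z; now apply in_chart_partial_y.
  + refine (ex_derive_ext_loc _ _ _ _ (Exy _ Dq)); now apply in_chart_partial_x.
- intros e.
  generalize (locally_chart _ _
    (Cyx p Dp (fun z => Rabs (z - partial ax_x (partial ax_y G) p) < e) (locally_ball _ e))).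
  apply locally_2d_impl, locally_2d_forall; intros u v [Hv H].
  rewrite <- (Pxy _ _ Hv), <- (Pxy _ _ (py_pos p)); now destruct p.
- intros e.
  generalize (locally_chart _ _
    (Cxy p Dp (fun z => Rabs (z - partial ax_y (partial ax_x G) p) < e) (locally_ball _ e))).
  apply locally_2d_impl, locally_2d_forall; intros u v [Hv H].
  rewrite <- (Pyx _ _ Hv), <- (Pyx _ _ (py_pos p)); now destruct p.
Qed.

End Chart.

(** * The Ricci identity *)

Lemma partial_ext (i : axis) (G G' : H2 -> R) (p : H2) :
  (forall q, G q = G' q) -> partial i G p = partial i G' p.
Proof.
intros H; destruct i; apply Derive_ext; intros z; simpl; unfold in_chart.
- destruct (Rlt_dec 0 (py p)); auto.
- destruct (Rlt_dec 0 z); auto.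
Qed.

Lemma partial_metric (i j l : axis) (p : H2) :
  partial i (metric j l) p =
  match i with
  | ax_x => 0
  | ax_y => if axis_eqb j l then - 2 / py p ^ 3 else 0
  end.
Proof.
assert (Hy := py_pos p).
destruct i; unfold partial; simpl.
- rewrite (Derive_ext _ (fun _ => metric j l p)); [apply Derive_const|].
  now intros t; rewrite (in_chart_mkH2 _ _ _ Hy).
- rewrite (Derive_ext_loc _ (fun y => if axis_eqb j l then / y ^ 2 else 0)).
  + destruct (axis_eqb j l); [|apply Derive_const].
    apply is_derive_unique; auto_derive; [nra | field; lra].
  + apply (locally_open (fun z => 0 < z)); [apply open_gt | | exact Hy].
    now intros z Hz; rewrite (in_chart_mkH2 _ _ _ Hz).
Qed.

Lemma Christoffel_eq (k i j : axis) (p : H2) :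
  Christoffel k i j p =
  match k, i, j with
  | ax_x, ax_x, ax_y | ax_x, ax_y, ax_x | ax_y, ax_y, ax_y => - / py p
  | ax_y, ax_x, ax_x => / py p
  | _, _, _ => 0
  end.
Proof.
assert (Hy := py_pos p).
unfold Christoffel, sum_axis, metric_inv; rewrite !partial_metric.
destruct k, i, j; simpl; field; lra.
Qed.

Lemma hess_comp_eq (F : H2 -> R) (i j : axis) (p : H2) :
  hess_comp F i j p = partial i (partial j F) p +
  match i, j with
  | ax_x, ax_x => - partial ax_y F p / py p
  | ax_y, ax_y => partial ax_y F p / py p
  | _, _ => partial ax_x F p / py p
  end.
Proof.
assert (Hy := py_pos p).
unfold hess_comp, sum_axis; rewrite !Christoffel_eq.
destruct i, j; field; lra.
Qed.

(** By [hess_comp_eq] every Hessian component has this shape with s = 1 or s = -1, so one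
    computation covers all their derivatives. *)
Lemma partial_add_div_py (l : axis) (A B : H2 -> R) (s : R) (p : H2) :
  ex_partial l A p -> ex_partial l B p ->
  partial l (fun q => A q + s * B q / py q) p =
  partial l A p + s * partial l B p / py p
  - match l with ax_x => 0 | ax_y => s * B p / py p ^ 2 end.
Proof.
intros HA HB; assert (Hy := py_pos p).
destruct l; unfold partial, ex_partial in *; simpl in *;
 set (a := in_chart A) in *; set (b := in_chart B) in *.
- rewrite (Derive_ext _ (fun x => a x (py p) + s * b x (py p) / py p)).
  + apply is_derive_unique; auto_derive; [repeat split; auto|].
    field; lra.
  + intros t; unfold a, b; now rewrite !(in_chart_mkH2 _ _ _ Hy).
- rewrite (Derive_ext_loc _ (fun y => a (px p) y + s * b (px p) y / y)).
  + apply is_derive_unique; auto_derive; [repeat split; auto; lra|].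
    unfold b at 2; rewrite in_chart_coord. field; lra.
  + apply (locally_open (fun z => 0 < z)); [apply open_gt | | exact Hy].
    intros z Hz; unfold a, b; now rewrite !(in_chart_mkH2 _ _ _ Hz).
Qed.

Lemma partial_hess_comp (F : H2 -> R) (l i j : axis) (p : H2) :
  ex_partial l (partial i (partial j F)) p ->
  ex_partial l (partial ax_x F) p -> ex_partial l (partial ax_y F) p ->
  partial l (hess_comp F i j) p = partial l (partial i (partial j F)) p +
  match i, j with
  | ax_x, ax_x => - partial l (partial ax_y F) p / py p +
      match l with ax_x => 0 | ax_y => partial ax_y F p / py p ^ 2 end
  | ax_y, ax_y => partial l (partial ax_y F) p / py p -
      match l with ax_x => 0 | ax_y => partial ax_y F p / py p ^ 2 end
  | _, _ => partial l (partial ax_x F) p / py p -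
      match l with ax_x => 0 | ax_y => partial ax_x F p / py p ^ 2 end
  end.
Proof.
intros H H1 H2; assert (Hy := py_pos p).
rewrite (partial_ext l _ (fun q => partial i (partial j F) q +
   match i, j with ax_x, ax_x => - 1 | _, _ => 1 end *
   match i, j with ax_x, ax_y | ax_y, ax_x => partial ax_x F | _, _ => partial ax_y F end q / py q)).
- rewrite partial_add_div_py; destruct i, j; auto; destruct l; field; lra.
- intros q; rewrite hess_comp_eq; assert (Hq := py_pos q); destruct i, j; field; lra.
Qed.

(** Components with respect to the orthonormal frame (y d/dx, y d/dy): unit vectors are those with
    a^2 + b^2 = 1, and (-b, a) is a quarter turn of (a, b). *)
Definition frame (p : H2) (a b : R) : tangent :=
  fun k => match k with ax_x => py p * a | ax_y => py p * b end.

Section Derivatives.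

Variables (D : H2 -> Prop) (F : H2 -> R).
Hypothesis D_open : open D.
Hypothesis F_C3 : C_on 3 D F.

Lemma C3_ex_partial (l i j : axis) (p : H2) : D p ->
  ex_partial l (partial i (partial j F)) p /\ ex_partial l (partial i F) p.
Proof.
intros Dp.
destruct F_C3 as [_ H1], (H1 i) as [_ [_ Hi]], (H1 j) as [_ [_ Hj]],
  (Hj i) as [_ [_ Hij]].
now split; [apply (Hij l) | apply (Hi l)].
Qed.

(** Schwarz's theorem for [partial j F] cancels the third-order partials. What remains is the term
    g_{yj} F_x - g_{xj} F_y of constant curvature -1. *)
Lemma third_comp_commutator (j : axis) (p : H2) : D p ->
  third_comp F ax_x ax_y j p - third_comp F ax_y ax_x j p =
  match j with
  | ax_x => - partial ax_y F p / py p ^ 2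
  | ax_y => partial ax_x F p / py p ^ 2
  end.
Proof.
intros Dp; assert (Hy := py_pos p).
assert (H1 := partial_comm D D_open F p (C_on_le _ _ _ F_C3) Dp).
destruct F_C3 as [_ H].
assert (H2 := partial_comm D D_open _ p (proj2 (H j)) Dp).
assert (E := fun l i j => proj1 (C3_ex_partial l i j p Dp)).
assert (E' := fun l i => proj2 (C3_ex_partial l i ax_x p Dp)).
unfold third_comp, sum_axis.
rewrite (partial_hess_comp F ax_x ax_y j), (partial_hess_comp F ax_y ax_x j) by auto.
rewrite (Christoffel_eq ax_x ax_x ax_y), (Christoffel_eq ax_y ax_x ax_y),
  (Christoffel_eq ax_x ax_y ax_x), (Christoffel_eq ax_y ax_y ax_x).
destruct j; rewrite !Christoffel_eq, !hess_comp_eq, H2; [rewrite H1|]; field; lra.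
Qed.

(** For u = (a, b) and v = (-b, a) the curvature term is g(v,v) dF(u) - g(u,v) dF(v), and v is
    orthogonal to u. *)
Lemma third_frame_commutator (p : H2) (a b : R) : D p ->
  third F p (frame p a b) (frame p (- b) a) (frame p (- b) a)
  - third F p (frame p (- b) a) (frame p a b) (frame p (- b) a)
  = (a ^ 2 + b ^ 2) * inner p (grad F p) (frame p a b).
Proof.
intros Dp; assert (Hy := py_pos p).
assert (Hx := third_comp_commutator ax_x p Dp).
assert (Hyy := third_comp_commutator ax_y p Dp); cbv iota beta in Hx, Hyy.
apply (Rplus_eq_compat_r (third_comp F ax_y ax_x ax_x p)) in Hx.
apply (Rplus_eq_compat_r (third_comp F ax_y ax_x ax_y p)) in Hyy.
unfold Rminus in Hx, Hyy; rewrite Rplus_assoc, Rplus_opp_l, Rplus_0_r in Hx, Hyy.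
unfold third, inner, grad, sum_axis, frame, metric_inv, metric; simpl axis_eqb; cbv iota.
rewrite Hx, Hyy; field; lra.
Qed.

End Derivatives.

(** * Derivatives along geodesics *)

Section Along.

Variables (D : H2 -> Prop) (F : H2 -> R).
Hypothesis D_open : open D.
Hypothesis F_C3 : C_on 3 D F.

(* In the orthonormal frame (y d/dx, y d/dy) the geodesic equation for the
   velocity (a, b) reads a' = a b, b' = - a^2. *)
Variables (gamma : R -> H2) (a b : R -> R) (t : R).
Hypothesis D_t : D (gamma t).
Hypothesis px_gamma : is_derive (fun s => px (gamma s)) t (py (gamma t) * a t).
Hypothesis py_gamma : is_derive (fun s => py (gamma s)) t (py (gamma t) * b t).
Hypothesis a_deriv : is_derive a t (a t * b t).
Hypothesis b_deriv : is_derive b t (- a t ^ 2).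

Let V (s : R) : tangent := frame (gamma s) (a s) (b s).

Lemma is_derive_along_1 :
  is_derive (fun s => F (gamma s)) t (inner (gamma t) (grad F (gamma t)) (V t)).
Proof.
assert (Hy := py_pos (gamma t)).
assert (H := is_derive_along D D_open F gamma t _ _
  (C_on_le _ _ _ (C_on_le _ _ _ F_C3)) D_t px_gamma py_gamma).
replace (inner _ _ _) with (partial ax_x F (gamma t) * (py (gamma t) * a t)
  + partial ax_y F (gamma t) * (py (gamma t) * b t)); [exact H|].
unfold inner, grad, sum_axis, V, frame, metric_inv, metric; simpl; field; lra.
Qed.

(** The equations for [a] and [b] make V parallel along [gamma] at [t], so differentiating a tensor
    evaluated on V differentiates the tensor only. The same reason gives the third derivative. *)
Lemma is_derive_along_2 :
  is_derive (fun s => inner (gamma s) (grad F (gamma s)) (V s)) t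
    (hess F (gamma t) (V t) (V t)).
Proof.
assert (Hy := py_pos (gamma t)).
destruct F_C3 as [_ H].
assert (Hi := fun i => is_derive_along D D_open _ gamma t _ _
  (C_on_le 1 _ _ (proj2 (H i))) D_t px_gamma py_gamma).
assert (Hx := Hi ax_x); assert (Hyy := Hi ax_y); clear Hi.
set (y := fun s => py (gamma s)) in *.
set (fx := fun s => partial ax_x F (gamma s)) in *.
set (fy := fun s => partial ax_y F (gamma s)) in *.
apply (is_derive_ext (fun s => y s * (fx s * a s + fy s * b s))).
{ intros s; assert (Hs := py_pos (gamma s)).
  unfold inner, grad, sum_axis, V, frame, metric_inv, metric, y, fx, fy; simpl; field; lra. }
auto_derive; [repeat split; eexists; eassumption|].
rewrite (is_derive_unique (fun s : R => y s) t _ py_gamma), (is_derive_unique (fun s : R => a s) t _ a_deriv),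
  (is_derive_unique (fun s : R => b s) t _ b_deriv), (is_derive_unique (fun s : R => fx s) t _ Hx), (is_derive_unique (fun s : R => fy s) t _ Hyy).
unfold y, fx, fy, hess, sum_axis, V, frame; rewrite !hess_comp_eq; field; lra.
Qed.

Lemma is_derive_along_3 :
  is_derive (fun s => hess F (gamma s) (V s) (V s)) t (third F (gamma t) (V t) (V t) (V t)).
Proof.
assert (Hy := py_pos (gamma t)).
assert (E := fun l i j => proj1 (C3_ex_partial D F F_C3 l i j (gamma t) D_t)).
assert (E' := fun l i => proj2 (C3_ex_partial D F F_C3 l i ax_x (gamma t) D_t)).
destruct F_C3 as [_ H].
assert (Hi := fun i => is_derive_along D D_open _ gamma t _ _
  (C_on_le 1 _ _ (proj2 (H i))) D_t px_gamma py_gamma).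
assert (Hij := fun i j => is_derive_along D D_open _ gamma t _ _
  (proj2 (proj2 (proj2 (H j)) i)) D_t px_gamma py_gamma).
assert (Hx := Hi ax_x); assert (Hyy := Hi ax_y); clear Hi.
assert (H11 := Hij ax_x ax_x); assert (H12 := Hij ax_x ax_y).
assert (H21 := Hij ax_y ax_x); assert (H22 := Hij ax_y ax_y); clear Hij.
set (y := fun s => py (gamma s)) in *.
set (fx := fun s => partial ax_x F (gamma s)) in *.
set (fy := fun s => partial ax_y F (gamma s)) in *.
set (fxx := fun s => partial ax_x (partial ax_x F) (gamma s)) in *.
set (fxy := fun s => partial ax_x (partial ax_y F) (gamma s)) in *.
set (fyx := fun s => partial ax_y (partial ax_x F) (gamma s)) in *.
set (fyy := fun s => partial ax_y (partial ax_y F) (gamma s)) in *.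
apply (is_derive_ext (fun s => y s ^ 2 *
    (fxx s * a s ^ 2 + (fxy s + fyx s) * a s * b s + fyy s * b s ^ 2)
  + y s * (fy s * (b s ^ 2 - a s ^ 2) + 2 * fx s * a s * b s))).
{ intros s; assert (Hs := py_pos (gamma s)).
  unfold hess, sum_axis, V, frame, y, fx, fy, fxx, fxy, fyx, fyy;
  rewrite !hess_comp_eq.
  match goal with |- ?u = ?v => change (@eq R u v) end; field; lra. }
auto_derive; [repeat split; eexists; eassumption|].
rewrite (is_derive_unique (fun s : R => y s) t _ py_gamma), (is_derive_unique (fun s : R => a s) t _ a_deriv),
  (is_derive_unique (fun s : R => b s) t _ b_deriv), (is_derive_unique (fun s : R => fx s) t _ Hx), (is_derive_unique (fun s : R => fy s) t _ Hyy),
  (is_derive_unique (fun s : R => fxx s) t _ H11), (is_derive_unique (fun s : R => fxy s) t _ H12),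
  (is_derive_unique (fun s : R => fyx s) t _ H21), (is_derive_unique (fun s : R => fyy s) t _ H22).
unfold y, fx, fy, fxx, fxy, fyx, fyy.
unfold third, third_comp, sum_axis.
rewrite !(partial_hess_comp F _ _ _ (gamma t)) by auto.
rewrite !Christoffel_eq, !hess_comp_eq.
unfold V, frame; field; lra.
Qed.

End Along.

(** * Explicit geodesics *)

Lemma cosh2_sinh2 (t : R) : cosh t ^ 2 = 1 + sinh t ^ 2.
Proof.
unfold cosh, sinh; assert (H : exp t * exp (- t) = 1).
{ rewrite <- exp_plus, Rplus_opp_r; apply exp_0. }
nra.
Qed.

Lemma cosh_double (t : R) : cosh t = 1 + 2 * sinh (t / 2) ^ 2.
Proof.
unfold cosh, sinh.
assert (H : exp (t / 2) * exp (- (t / 2)) = 1).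
{ rewrite <- exp_plus, Rplus_opp_r; apply exp_0. }
replace (exp t) with (exp (t / 2) ^ 2).
replace (exp (- t)) with (exp (- (t / 2)) ^ 2).
nra.
all: simpl; rewrite Rmult_1_r, <- exp_plus; f_equal; lra.
Qed.

Definition geo_den (b t : R) : R := cosh t - b * sinh t.

Lemma geo_den_pos (a b t : R) : a ^ 2 + b ^ 2 = 1 -> 0 < geo_den b t.
Proof.
intros H; unfold geo_den, cosh, sinh.
assert (H1 := exp_pos t); assert (H2 := exp_pos (- t)).
assert (Hb : -1 <= b <= 1) by (split; nra).
destruct (Rle_dec b 0); nra.
Qed.

Lemma geo_py_pos (p : H2) (a b t : R) : a ^ 2 + b ^ 2 = 1 -> 0 < py p / geo_den b t.
Proof.
intros H; apply Rdiv_lt_0_compat; [apply py_pos | now apply geo_den_pos with a].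
Qed.

(* Unit-speed geodesic from p with initial velocity (a, b) in the orthonormal
   frame (y d/dx, y d/dy). *)
Definition geo (p : H2) (a b : R) (H : a ^ 2 + b ^ 2 = 1) (t : R) : H2 :=
  mkH2 (px p + py p * a * sinh t / geo_den b t) (py p / geo_den b t)
       (geo_py_pos p a b t H).

(** [geo_a] and [geo_b] are the components of the velocity of [geo] at time t in the orthonormal
    frame at the moving point. *)
Definition geo_a (a b t : R) : R := a / geo_den b t.
Definition geo_b (b t : R) : R := (b * cosh t - sinh t) / geo_den b t.

Lemma geo_ab_unit (a b t : R) :
  a ^ 2 + b ^ 2 = 1 -> geo_a a b t ^ 2 + geo_b b t ^ 2 = 1.
Proof.
intros H; assert (HE := geo_den_pos a b t H).
unfold geo_a, geo_b.
apply (Rmult_eq_reg_r (geo_den b t ^ 2)); [|apply pow_nonzero; lra].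
replace (_ * _) with (a ^ 2 + (b * cosh t - sinh t) ^ 2) by (field; lra).
unfold geo_den; assert (Hc := cosh2_sinh2 t).
replace (a ^ 2) with (1 - b ^ 2) by lra.
nra.
Qed.

Lemma geo_0 (p : H2) (a b : R) (H : a ^ 2 + b ^ 2 = 1) : geo p a b H 0 = p.
Proof.
apply H2_ext; simpl; unfold geo_den; rewrite sinh_0, cosh_0; field.
Qed.

Lemma geo_a_0 (a b : R) : geo_a a b 0 = a.
Proof. unfold geo_a, geo_den; rewrite sinh_0, cosh_0; field. Qed.

Lemma geo_b_0 (b : R) : geo_b b 0 = b.
Proof. unfold geo_b, geo_den; rewrite sinh_0, cosh_0; field. Qed.

Lemma is_derive_sinh (t : R) : is_derive sinh t (cosh t).
Proof. apply is_derive_Reals, derivable_pt_lim_sinh. Qed.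

Lemma is_derive_cosh (t : R) : is_derive cosh t (sinh t).
Proof. apply is_derive_Reals, derivable_pt_lim_cosh. Qed.

Section Geodesic.

Variables (p : H2) (a b : R) (H : a ^ 2 + b ^ 2 = 1) (t : R).

(* Generalizing sinh and cosh keeps auto_derive from running for minutes. *)
Ltac derive_hyperbolic :=
  assert (HE := geo_den_pos a b t H); assert (Hc := cosh2_sinh2 t);
  simpl; unfold geo_a, geo_b, geo_den in *;
  generalize (is_derive_sinh t) (is_derive_cosh t);
  revert Hc HE;
  generalize sinh cosh; intros sh ch Hc HE Hs Hch;
  auto_derive;
  [ repeat split; try (eexists; eassumption); apply Rgt_not_eq; lra
  | rewrite ?(is_derive_unique (fun x : R => sh x) t _ Hs),
      ?(is_derive_unique (fun x : R => ch x) t _ Hch) ].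

Lemma is_derive_geo_py :
  is_derive (fun s => py (geo p a b H s)) t (py (geo p a b H t) * geo_b b t).
Proof. derive_hyperbolic; field; lra. Qed.

Lemma is_derive_geo_px :
  is_derive (fun s => px (geo p a b H s)) t (py (geo p a b H t) * geo_a a b t).
Proof.
derive_hyperbolic.
transitivity (py p * a * (ch t ^ 2 - sh t ^ 2) / (ch t - b * sh t) ^ 2).
- field; lra.
- rewrite Hc; field; lra.
Qed.

Lemma is_derive_geo_a :
  is_derive (geo_a a b) t (geo_a a b t * geo_b b t).
Proof. derive_hyperbolic; field; lra. Qed.

Lemma is_derive_geo_b :
  is_derive (geo_b b) t (- geo_a a b t ^ 2).
Proof.
derive_hyperbolic.
transitivity ((b ^ 2 - 1) * (ch t ^ 2 - sh t ^ 2) / (ch t - b * sh t) ^ 2).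
- field; lra.
- rewrite Hc; replace (b ^ 2 - 1) with (- a ^ 2) by lra; field; lra.
Qed.

End Geodesic.

Lemma hdist_geo (p : H2) (a b : R) (H : a ^ 2 + b ^ 2 = 1) (t : R) :
  0 <= t -> hdist p (geo p a b H t) = t.
Proof.
intros Ht; assert (HE := geo_den_pos a b t H).
assert (Hp := py_pos p); assert (Hq := geo_py_pos p a b t H).
assert (Hs : 0 <= sinh (t / 2)).
{ destruct (Req_dec t 0) as [-> | Hn].
  - unfold Rdiv; rewrite Rmult_0_l, sinh_0; lra.
  - apply Rlt_le, sinh_pos; lra. }
assert (Hr := sqrt_lt_R0 _ (Rmult_lt_0_compat _ _ Hp Hq)).
unfold hdist.
replace (_ / _) with (sinh (t / 2)); [rewrite arcsinh_sinh; field|].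
apply (Rmult_eq_reg_r (2 * sqrt (py p * py (geo p a b H t)))); [|simpl; lra].
unfold Rdiv at 2; rewrite Rmult_assoc, Rinv_l, Rmult_1_r by (simpl; lra).
unfold Cmod, toC.
rewrite <- (sqrt_pow2 (_ * _)) by (apply Rmult_le_pos; simpl; lra).
f_equal; rewrite Rpow_mult_distr, Rpow_mult_distr, pow2_sqrt by (simpl; nra).
simpl fst; simpl snd; simpl px; simpl py.
assert (H1 := cosh_double t); assert (Hc := cosh2_sinh2 t).
replace (sinh (t / 2) ^ 2) with ((cosh t - 1) / 2) by lra.
unfold geo_den in *.
revert H1 Hc HE; generalize (sinh t) (cosh t); intros s c _ Hc HE.
apply (Rmult_eq_reg_r ((c - b * s) ^ 2)); [|apply pow_nonzero; lra].
transitivity (py p ^ 2 * (c - b * s) * (2 * c - 2)); [field; lra|].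
transitivity (py p ^ 2 * (a ^ 2 * s ^ 2 + (c - b * s - 1) ^ 2)); [|field; lra].
rewrite Rmult_assoc; f_equal; replace (a ^ 2) with (1 - b ^ 2) by lra; nra.
Qed.

Lemma geo_exists (p q : H2) : 0 < hdist p q ->
  exists a b (H : a ^ 2 + b ^ 2 = 1), geo p a b H (hdist p q) = q.
Proof.
intros Hl; assert (Hp := py_pos p); assert (Hq := py_pos q).
set (l := hdist p q) in *.
assert (Hs := sinh_pos l Hl).
assert (Hc : cosh l = 1 + ((px p - px q) ^ 2 + (py p - py q) ^ 2) / (2 * py p * py q)).
{ rewrite cosh_double; unfold l, hdist.
  replace (2 * _ / 2) with (arcsinh (Cmod (toC p - toC q)%C / (2 * sqrt (py p * py q)))) by field.
  rewrite sinh_arcsinh.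
  assert (Hr := half_sqrt_pos p q).
  unfold Rdiv; rewrite Rpow_mult_distr, pow_inv, Rpow_mult_distr.
  rewrite pow2_sqrt by nra.
  unfold Cmod; rewrite pow2_sqrt by (apply Rplus_le_le_0_compat; apply pow2_ge_0).
  simpl; field; lra. }
assert (Hcs := cosh2_sinh2 l).
(* Matching heights at time l forces [geo_den b l = py p / py q], which determines b; matching
   abscissas then determines a. That (a, b) is a unit vector is the formula [Hc] for cosh l. *)
set (a := (px q - px p) / (py q * sinh l)).
set (b := (cosh l - py p / py q) / sinh l).
assert (H : a ^ 2 + b ^ 2 = 1).
{ apply (Rmult_eq_reg_r (py q ^ 2 * sinh l ^ 2)); [|apply Rgt_not_eq, Rmult_lt_0_compat; apply pow_lt; assumption].
  transitivity ((px q - px p) ^ 2 + (py q * cosh l - py p) ^ 2); [unfold a, b; field; lra|].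
  rewrite Rmult_1_l; replace (sinh l ^ 2) with (cosh l ^ 2 - 1) by lra.
  transitivity (py q ^ 2 * cosh l ^ 2 - 2 * py q * py p * cosh l
    + (py p ^ 2 + (px p - px q) ^ 2)); [ring|].
  rewrite Hc; field; lra. }
exists a, b, H.
assert (HE : geo_den b l = py p / py q) by (unfold geo_den, b; field; lra).
apply H2_ext; simpl; rewrite HE; unfold a; field; lra.
Qed.

(** * Self-concordance in dimension one *)

Lemma derive_nonneg_le (f df : R -> R) (s t : R) : s <= t ->
  (forall x, s <= x <= t -> is_derive f x (df x) /\ 0 <= df x) -> f s <= f t.
Proof.
intros [Hst | ->] H; [|lra].
destruct (MVT_cor2 f df s t Hst) as [x [Hx Hi]].
- intros x Hx; apply is_derive_Reals, H, Hx.
- assert (0 <= df x) by (apply H; lra). nra.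
Qed.

Section SelfConcordant1D.

Variables (g h k : R -> R) (L : R).
Hypothesis g_deriv : forall t, 0 <= t < L -> is_derive g t (h t).
Hypothesis h_deriv : forall t, 0 <= t < L -> is_derive h t (k t).
Hypothesis h_pos : forall t, 0 <= t < L -> 0 < h t.
Hypothesis k_bound : forall t, 0 <= t < L ->
  Rabs (k t) <= 2 * sqrt (h t) * sqrt (h t) * sqrt (h t).

(** With [g], [h], [k] as first, second and third derivatives of a function, self-concordance says
    exactly that h^{-1/2} has slope between -1 and 1. *)
Lemma is_derive_inv_sqrt (t : R) : 0 <= t < L ->
  is_derive (fun s => / sqrt (h s)) t (- k t / (2 * sqrt (h t) ^ 3)) /\
  -1 <= - k t / (2 * sqrt (h t) ^ 3) <= 1.
Proof.
intros Ht; assert (Hp := h_pos t Ht); assert (Hs := sqrt_lt_R0 _ Hp).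
split.
- assert (Hd := h_deriv t Ht).
  auto_derive; [repeat split; [eexists; exact Hd | lra | lra]|].
  rewrite (is_derive_unique (fun x : R => h x) t _ Hd); field; lra.
- assert (H3 : 0 < sqrt (h t) ^ 3) by (apply pow_lt, Hs).
  assert (Hk := k_bound t Ht); apply Rabs_le_between in Hk.
  split; [apply Rle_div_r | apply Rle_div_l]; simpl in *; lra.
Qed.

Lemma inv_sqrt_lipschitz (t : R) : 0 <= t < L ->
  / sqrt (h 0) - t <= / sqrt (h t) <= / sqrt (h 0) + t.
Proof.
intros Ht; split.
- assert (H := derive_nonneg_le (fun s => / sqrt (h s) + s)
    (fun s => - k s / (2 * sqrt (h s) ^ 3) + 1) 0 t (proj1 Ht)).
  enough (/ sqrt (h 0) + 0 <= / sqrt (h t) + t) by lra; apply H.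
  intros x Hx; destruct (is_derive_inv_sqrt x) as [H1 H2]; [lra|]; split; [|lra].
  apply (is_derive_plus (fun s => / sqrt (h s)) (fun s => s)); [exact H1 | exact (is_derive_id x)].
- assert (H := derive_nonneg_le (fun s => s - / sqrt (h s))
    (fun s => 1 - - k s / (2 * sqrt (h s) ^ 3)) 0 t (proj1 Ht)).
  enough (0 - / sqrt (h 0) <= t - / sqrt (h t)) by lra; apply H.
  intros x Hx; destruct (is_derive_inv_sqrt x) as [H1 H2]; [lra|]; split; [|lra].
  apply (is_derive_minus (fun s => s) (fun s => / sqrt (h s))); [exact (is_derive_id x) | exact H1].
Qed.

Lemma inv_sqrt_h0_pos : 0 < L -> 0 < / sqrt (h 0).
Proof. intros HL; apply Rinv_0_lt_compat, sqrt_lt_R0, h_pos; lra. Qed.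

Lemma h_inv_sqrt (t : R) : 0 <= t < L -> h t = / (/ sqrt (h t)) ^ 2.
Proof.
intros Ht; assert (Hp := h_pos t Ht).
rewrite pow_inv, pow2_sqrt by lra; field; lra.
Qed.

(** With a = h(0)^{-1/2}, the upper Lipschitz bound gives h(s) >= (a + s)^{-2}; integrate from 0 to
    t. *)
Lemma gradient_growth (t : R) : 0 <= t < L ->
  g 0 + / / sqrt (h 0) - / (/ sqrt (h 0) + t) <= g t.
Proof.
intros Ht; assert (Ha := inv_sqrt_h0_pos ltac:(lra)).
set (a := / sqrt (h 0)) in *.
assert (H := derive_nonneg_le (fun s => g s + / (a + s)) (fun s => h s - / (a + s) ^ 2)
  0 t (proj1 Ht)).
enough (g 0 + / (a + 0) <= g t + / (a + t)) by (rewrite Rplus_0_r in *; lra).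
apply H; intros x Hx; split.
- assert (Hd := g_deriv x ltac:(lra)).
  auto_derive; [repeat split; [eexists; exact Hd | lra]|].
  rewrite (is_derive_unique (fun x : R => g x) x _ Hd); field; lra.
- assert (Hi := inv_sqrt_lipschitz x ltac:(lra)).
  rewrite h_inv_sqrt by lra.
  assert (0 < / sqrt (h x)) by (apply Rinv_0_lt_compat, sqrt_lt_R0, h_pos; lra).
  fold a in Hi.
  enough (/ (a + x) ^ 2 <= / (/ sqrt (h x)) ^ 2) by lra.
  apply Rinv_le_contravar; [apply pow_lt; lra | apply pow_incr; lra].
Qed.

(** With a = h(0)^{-1/2}, the lower Lipschitz bound gives h(s) <= (a - s)^{-2}, which stays finite
    for s <= l < a. Integrating once bounds g from above, and a second time f. *)
Lemma bounded_before_dikin (f : R -> R) (l : R) :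
  (forall t, 0 <= t < L -> is_derive f t (g t)) ->
  L <= l -> l < / sqrt (h 0) -> exists M, forall t, 0 <= t < L -> f t <= M.
Proof.
intros f_deriv HL Hl; set (a := / sqrt (h 0)) in *.
assert (Hg : forall t, 0 <= t < L -> g t <= g 0 + / (a - l)).
{ intros t Ht; assert (Ha := inv_sqrt_h0_pos ltac:(lra)); fold a in Ha.
  assert (H := derive_nonneg_le (fun s => / (a - s) - g s) (fun s => / (a - s) ^ 2 - h s)
    0 t (proj1 Ht)).
  assert (H1 : / (a - 0) - g 0 <= / (a - t) - g t).
  { apply H; intros x Hx; split.
    - assert (Hd := g_deriv x ltac:(lra)).
      auto_derive; [repeat split; [lra | eexists; exact Hd]|].
      rewrite (is_derive_unique (fun x : R => g x) x _ Hd); field; lra.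
    - assert (Hi := inv_sqrt_lipschitz x ltac:(lra)); fold a in Hi.
      rewrite h_inv_sqrt by lra.
      enough (/ (/ sqrt (h x)) ^ 2 <= / (a - x) ^ 2) by lra.
      apply Rinv_le_contravar; [apply pow_lt; lra | apply pow_incr; lra]. }
  assert (/ (a - t) <= / (a - l)) by (apply Rinv_le_contravar; lra).
  assert (0 < / (a - 0)) by (apply Rinv_0_lt_compat; lra). lra. }
set (m := g 0 + / (a - l)) in *.
exists (f 0 + Rabs m * L); intros t Ht.
assert (H := derive_nonneg_le (fun s => m * s - f s) (fun s => m - g s) 0 t (proj1 Ht)).
assert (H1 : m * 0 - f 0 <= m * t - f t).
{ apply H; intros x Hx; split; [|generalize (Hg x ltac:(lra)); lra].
  assert (Hd := f_deriv x ltac:(lra)).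
  auto_derive; [eexists; exact Hd|].
  rewrite (is_derive_unique (fun x : R => f x) x _ Hd); ring. }
assert (H2 := Rle_abs m); assert (H3 := Rabs_pos m). nra.
Qed.

(* g' >= g^2 / theta forces blow-up of g within time theta / g(s). *)
Lemma blow_up_time (theta s t : R) :
  0 <= theta -> (forall x, 0 <= x < L -> g x ^ 2 <= theta * h x) ->
  0 <= s <= t -> t < L -> 0 < g s -> (t - s) * g s <= theta.
Proof.
intros Hth Hb Hs Ht Hgs.
assert (Hg : forall x, s <= x <= t -> g s <= g x).
{ intros x Hx; apply (derive_nonneg_le g h); [lra|].
  intros z Hz; split; [apply g_deriv | apply Rlt_le, h_pos]; lra. }
(* The derivative of - theta / g is theta h / g^2 >= 1, so theta / g drops at least at unit rate
   while remaining nonnegative. *)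
assert (H := derive_nonneg_le (fun x => - (theta / g x) - x)
  (fun x => theta * h x / g x ^ 2 - 1) s t (proj2 Hs)).
assert (H1 : - (theta / g s) - s <= - (theta / g t) - t).
{ apply H; intros x Hx; assert (Hx' := Hg x Hx); split.
  - assert (Hd := g_deriv x ltac:(lra)).
    auto_derive; [repeat split; [eexists; exact Hd | lra]|].
    rewrite (is_derive_unique (fun x : R => g x) x _ Hd); field; lra.
  - assert (H2 := Hb x ltac:(lra)).
    enough (1 <= theta * h x / g x ^ 2) by lra.
    apply Rle_div_r; [apply pow_lt|]; lra. }
assert (H2 := Hg t ltac:(lra)).
assert (0 <= theta / g t) by (apply Rdiv_le_0_compat; lra).
apply Rle_div_r; lra.
Qed.

End SelfConcordant1D.

(** * Barriers along geodesics *)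

Lemma continuous_curve (gamma : R -> H2) (t : R) :
  continuous (fun s => px (gamma s)) t -> continuous (fun s => py (gamma s)) t ->
  continuous gamma t.
Proof.
intros Hx Hy P HP; destruct (locally_chart P _ HP) as [d Hd].
assert (Hx' := Hx (fun u => Rabs (u - px (gamma t)) < d) (locally_ball _ d)).
assert (Hy' := Hy (fun u => Rabs (u - py (gamma t)) < d) (locally_ball _ d)).
unfold filtermap in *; generalize (filter_and _ _ Hx' Hy'); apply filter_imp; intros s [Hsx Hsy].
destruct (Hd _ _ Hsx Hsy) as [Hp H].
now rewrite (H2_ext (gamma s) (mkH2 (px (gamma s)) (py (gamma s)) Hp)).
Qed.

Lemma continuous_geo (p : H2) (a b : R) (H : a ^ 2 + b ^ 2 = 1) (t : R) :
  continuous (geo p a b H) t.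
Proof.
apply continuous_curve;
  apply (ex_derive_continuous (K := R_AbsRing) (V := R_NormedModule)); eexists.
- apply is_derive_geo_px.
- apply is_derive_geo_py.
Qed.

Definition slope (F : H2 -> R) (p : H2) (a b : R) : R := inner p (grad F p) (frame p a b).

Definition hess_dir (F : H2 -> R) (p : H2) (a b : R) : R :=
  hess F p (frame p a b) (frame p a b).

Lemma slope_opp (F : H2 -> R) (p : H2) (a b : R) : slope F p (- a) (- b) = - slope F p a b.
Proof. unfold slope, inner, sum_axis, frame; ring. Qed.

Lemma hess_dir_opp (F : H2 -> R) (p : H2) (a b : R) :
  hess_dir F p (- a) (- b) = hess_dir F p a b.
Proof. unfold hess_dir, hess, sum_axis, frame; ring. Qed.

Section Barrier.

Variables (D : H2 -> Prop) (F : H2 -> R) (theta : R).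
Hypothesis D_open : open D.
Hypothesis F_barrier : barrier theta D F.

Lemma frame_nonzero (p : H2) (a b : R) : a ^ 2 + b ^ 2 = 1 -> Defs.nonzero (frame p a b).
Proof.
intros H; assert (Hy := py_pos p); destruct (Req_dec a 0) as [-> | Ha].
- exists ax_y; simpl; apply Rmult_integral_contrapositive_currified; nra.
- exists ax_x; simpl; apply Rmult_integral_contrapositive_currified; lra.
Qed.

Lemma hess_dir_pos (p : H2) (a b : R) : D p -> a ^ 2 + b ^ 2 = 1 -> 0 < hess_dir F p a b.
Proof.
intros Dp H; destruct F_barrier as [_ [_ [Hpos _]]].
apply Hpos, frame_nonzero; assumption.
Qed.

Lemma slope_le (p : H2) (a b : R) : D p -> a ^ 2 + b ^ 2 = 1 ->
  slope F p a b <= sqrt theta * sqrt (hess_dir F p a b).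
Proof.
intros Dp H; assert (Hc := sqrt_lt_R0 _ (hess_dir_pos p a b Dp H)).
destruct F_barrier as [_ [_ [_ Hg]]].
apply Rle_div_l; [exact Hc|].
apply (Hg p Dp), frame_nonzero, H.
Qed.

(** The barrier inequality is one-sided; applying it to (a, b) and to its opposite bounds the
    absolute value. *)
Lemma slope_sqr_le (p : H2) (a b : R) : D p -> a ^ 2 + b ^ 2 = 1 ->
  slope F p a b ^ 2 <= theta * hess_dir F p a b.
Proof.
intros Dp H; assert (Hc := hess_dir_pos p a b Dp H).
assert (H1 := slope_le p a b Dp H).
assert (H2 := slope_le p (- a) (- b) Dp ltac:(lra)).
rewrite slope_opp, hess_dir_opp in H2.
assert (Hth := proj1 F_barrier).
rewrite <- (pow2_sqrt theta), <- (pow2_sqrt (hess_dir F p a b)), <- Rpow_mult_distr by lra.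
apply pow_maj_Rabs, Rabs_le; lra.
Qed.

Lemma third_frame_le (p : H2) (a b : R) : D p ->
  Rabs (third F p (frame p a b) (frame p a b) (frame p a b)) <=
  2 * sqrt (hess_dir F p a b) * sqrt (hess_dir F p a b) * sqrt (hess_dir F p a b).
Proof.
intros Dp; destruct F_barrier as [_ [[_ [Hsc _]] _]]; now apply Hsc.
Qed.

(* Noncommuting third derivatives make the Hessian in one direction pay for
   slope in the orthogonal one. *)
Lemma slope_le_hess_dir (p : H2) (a b : R) : D p -> a ^ 2 + b ^ 2 = 1 ->
  slope F p a b <= 4 * sqrt (hess_dir F p a b) * hess_dir F p (- b) a.
Proof.
intros Dp H; destruct F_barrier as [_ [[HC [Hsc _]] _]].
assert (Hr := third_frame_commutator D F D_open HC p a b Dp).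
fold (slope F p a b) in Hr; rewrite H, Rmult_1_l in Hr; rewrite <- Hr.
(* Both argument orders are at most 2 sqrt(F_11) F_22 in absolute value, which gives the factor
   4. *)
assert (H1 := Hsc p Dp (frame p a b) (frame p (- b) a) (frame p (- b) a)).
assert (H2 := Hsc p Dp (frame p (- b) a) (frame p a b) (frame p (- b) a)).
apply Rabs_le_between in H1, H2; unfold hess_dir.
assert (Hp := hess_dir_pos p (- b) a Dp ltac:(lra)).
rewrite <- (sqrt_sqrt (hess F p (frame p (- b) a) (frame p (- b) a))) by (unfold hess_dir in Hp; lra).
nra.
Qed.

Section AlongGeodesic.

Variables (p : H2) (a b : R) (H : a ^ 2 + b ^ 2 = 1) (t : R).
Hypothesis D_t : D (geo p a b H t).

Lemma is_derive_geo_1 :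
  is_derive (fun s => F (geo p a b H s)) t (slope F (geo p a b H t) (geo_a a b t) (geo_b b t)).
Proof.
apply is_derive_along_1 with D; try assumption.
- apply F_barrier.
- apply is_derive_geo_px.
- apply is_derive_geo_py.
Qed.

Lemma is_derive_geo_2 :
  is_derive (fun s => slope F (geo p a b H s) (geo_a a b s) (geo_b b s)) t
    (hess_dir F (geo p a b H t) (geo_a a b t) (geo_b b t)).
Proof.
apply is_derive_along_2 with D; try assumption.
- apply F_barrier.
- apply is_derive_geo_px.
- apply is_derive_geo_py.
- now apply is_derive_geo_a.
- now apply is_derive_geo_b.
Qed.

Lemma is_derive_geo_3 :
  is_derive (fun s => hess_dir F (geo p a b H s) (geo_a a b s) (geo_b b s)) t
    (third F (geo p a b H t) (frame (geo p a b H t) (geo_a a b t) (geo_b b t))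
      (frame (geo p a b H t) (geo_a a b t) (geo_b b t))
      (frame (geo p a b H t) (geo_a a b t) (geo_b b t))).
Proof.
apply is_derive_along_3 with D; try assumption.
- apply F_barrier.
- apply is_derive_geo_px.
- apply is_derive_geo_py.
- now apply is_derive_geo_a.
- now apply is_derive_geo_b.
Qed.

End AlongGeodesic.

(** Let T be the supremum of the times up to which the geodesic stays in [D]. If l were smaller than
    the Dikin radius, F would be bounded before T; the closed epigraph then puts the point at T in
    [D], and openness of [D] carries the geodesic past T. *)
Lemma dikin (p : H2) (a b : R) (H : a ^ 2 + b ^ 2 = 1) (l : R) :
  D p -> 0 <= l -> ~ D (geo p a b H l) -> / sqrt (hess_dir F p a b) <= l.
Proof.
intros Dp Hl Nl; apply Rnot_lt_le; intros Hlt.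
set (E := fun t => 0 <= t <= l /\ forall s, 0 <= s <= t -> D (geo p a b H s)).
assert (E0 : E 0).
{ split; [lra|]; intros s Hs; replace s with 0 by lra; now rewrite geo_0. }
destruct (completeness E) as [T [HT1 HT2]].
{ exists l; intros t [Ht _]; lra. }
{ now exists 0. }
assert (HT0 : 0 <= T) by (apply HT1, E0).
assert (HTl : T <= l) by (apply HT2; intros t [Ht _]; lra).
assert (HD : forall t, 0 <= t < T -> D (geo p a b H t)).
{ intros t Ht; apply NNPP; intros Nt.
  assert (T <= t); [|lra].
  apply HT2; intros u [Hu1 Hu2]; apply Rnot_lt_le; intros Htu; apply Nt, Hu2; lra. }
assert (DT : D (geo p a b H T)).
{ destruct (Req_dec T 0) as [-> | HTn]; [now rewrite geo_0|].
  set (g := fun s => slope F (geo p a b H s) (geo_a a b s) (geo_b b s)).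
  set (h := fun s => hess_dir F (geo p a b H s) (geo_a a b s) (geo_b b s)).
  assert (Hh : h 0 = hess_dir F p a b) by (unfold h; now rewrite geo_0, geo_a_0, geo_b_0).
  destruct (bounded_before_dikin g h _ T
    (fun t Ht => is_derive_geo_2 p a b H t (HD t Ht))
    (fun t Ht => is_derive_geo_3 p a b H t (HD t Ht))
    (fun t Ht => hess_dir_pos _ _ _ (HD t Ht) (geo_ab_unit a b t H))
    (fun t Ht => third_frame_le _ (geo_a a b t) (geo_b b t) (HD t Ht))
    (fun s => F (geo p a b H s)) l
    (fun t Ht => is_derive_geo_1 p a b H t (HD t Ht)) HTl) as [M HM].
  { now rewrite Hh. }
  destruct F_barrier as [_ [[_ [_ Hcl]] _]].
  (* The points at height M over times t < T lie in the epigraph and tend to this one. A time t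
     close to T is cut off at 0 to stay in the domain. *)
  apply (Hcl (geo p a b H T, M)); intros [e He].
  destruct (continuous_geo p a b H T _ (locally_ball _ e)) as [d Hd].
  set (t := Rmax 0 (T - d / 2)).
  assert (Ht : 0 <= t < T).
  { split; [apply Rmax_l | apply Rmax_lub_lt; generalize (cond_pos d); lra]. }
  assert (Ht' : T - d / 2 <= t) by apply Rmax_r.
  apply (He (geo p a b H t, M)).
  - split; [apply Hd | apply ball_center].
    apply Rabs_def1; unfold minus, plus, opp; simpl; generalize (cond_pos d); lra.
  - split; [now apply HD | now apply HM]. }
destruct (Rle_lt_or_eq_dec T l HTl) as [HTlt | ->]; [|tauto].
destruct (continuous_geo p a b H T _ (D_open _ DT)) as [d Hd].
assert (Hdp := cond_pos d).
assert (Hm : 0 < Rmin (d / 2) (l - T)) by (apply Rmin_pos; lra).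
assert (Hm1 := Rmin_l (d / 2) (l - T)); assert (Hm2 := Rmin_r (d / 2) (l - T)).
set (m := Rmin _ _) in *.
(* [T + m] still belongs to [E]: times before T lie in [D] by [HD], the rest by openness of [D]. *)
assert (T + m <= T); [|lra].
apply HT1; split; [lra|]; intros s Hs.
destruct (Rlt_le_dec s T); [apply HD; lra|].
apply Hd, Rabs_def1; unfold minus, plus, opp; simpl; lra.
Qed.

(** Reversing a direction flips the slope and keeps the Hessian. A nonnegative initial slope can
    then be dropped from [gradient_growth]. *)
Lemma choose_sign (p : H2) (a b : R) : a ^ 2 + b ^ 2 = 1 ->
  exists a' b', a' ^ 2 + b' ^ 2 = 1 /\ 0 <= slope F p a' b' /\
    hess_dir F p a' b' = hess_dir F p a b.
Proof.
intros H; destruct (Rle_dec 0 (slope F p a b)) as [Hs | Hs].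
- now exists a, b.
- exists (- a), (- b); rewrite slope_opp, hess_dir_opp; repeat split; lra.
Qed.

Lemma ball_bound (c p : H2) (rho : R) : 4096 <= rho ->
  (forall q, hdist c q < rho -> D q) -> ~ D p -> hdist c p < rho + 1 ->
  rho <= 20 * theta + 13.
Proof.
intros Hrho Hball Np Hp.
assert (Dc : D c) by (apply Hball; rewrite hdist_refl; lra).
assert (Hl : rho <= hdist c p) by (apply Rnot_lt_le; intros Hlt; now apply Np, Hball).
destruct (geo_exists c p ltac:(lra)) as [a0 [b0 [H0 Hgeo]]].
assert (Halpha : / sqrt (hess_dir F c a0 b0) <= hdist c p).
{ apply (dikin c a0 b0 H0); [exact Dc | lra | now rewrite Hgeo]. }
destruct (choose_sign c a0 b0 H0) as [a [b [H [Hs Hcurv]]]].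
rewrite <- Hcurv in Halpha.
assert (HD : forall t, 0 <= t < rho -> D (geo c a b H t)).
{ intros t Ht; apply Hball; rewrite hdist_geo; lra. }
assert (Hpos := hess_dir_pos c a b Dc H).
set (al := / sqrt (hess_dir F c a b)) in *.
assert (Hal : 0 < al) by (apply Rinv_0_lt_compat, sqrt_lt_R0, Hpos).
assert (Ht : 0 <= al / 2 < rho) by lra.
set (q := geo c a b H (al / 2)).
set (a1 := geo_a a b (al / 2)); set (b1 := geo_b b (al / 2)).
assert (Hu : a1 ^ 2 + b1 ^ 2 = 1) by now apply geo_ab_unit.
assert (Dq : D q) by now apply HD.
(* At half the Dikin radius the slope has gained 1/al - 1/(3 al / 2) = 1/(3 al). *)
assert (Hslope : / (3 * al) <= slope F q a1 b1).
{ assert (Hg := gradient_growth _ _ _ rho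
    (fun t Ht => is_derive_geo_2 c a b H t (HD t Ht))
    (fun t Ht => is_derive_geo_3 c a b H t (HD t Ht))
    (fun t Ht => hess_dir_pos _ _ _ (HD t Ht) (geo_ab_unit a b t H))
    (fun t Ht => third_frame_le _ (geo_a a b t) (geo_b b t) (HD t Ht))
    (al / 2) Ht).
  cbv beta in Hg; rewrite geo_0, geo_a_0, geo_b_0 in Hg; fold al in Hg.
  replace (/ (3 * al)) with (/ al - / (al + al / 2)) by (field; lra).
  fold q a1 b1 in Hg; lra. }
assert (Hroot : sqrt (hess_dir F q a1 b1) <= 2 / al).
{ assert (Hi := inv_sqrt_lipschitz _ _ rho
    (fun t Ht => is_derive_geo_3 c a b H t (HD t Ht))
    (fun t Ht => hess_dir_pos _ _ _ (HD t Ht) (geo_ab_unit a b t H))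
    (fun t Ht => third_frame_le _ (geo_a a b t) (geo_b b t) (HD t Ht))
    (al / 2) Ht).
  cbv beta in Hi; rewrite geo_0, geo_a_0, geo_b_0 in Hi; fold al in Hi.
  fold q a1 b1 in Hi.
  assert (Hq := sqrt_lt_R0 _ (hess_dir_pos q a1 b1 Dq Hu)).
  rewrite <- (Rinv_inv (sqrt _)).
  replace (2 / al) with (/ (al / 2)) by (field; lra).
  apply Rinv_le_contravar; lra. }
assert (Hcurv2 : / 24 <= hess_dir F q (- b1) a1).
{ assert (Hq := sqrt_lt_R0 _ (hess_dir_pos q a1 b1 Dq Hu)).
  assert (Hsc := slope_le_hess_dir q a1 b1 Dq Hu).
  (* Since 1/(3 al) = (2/al)/6 and the root is at most 2/al, dividing [Hsc] by 4 times the root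
     leaves 1/24. *)
  assert (H6 : sqrt (hess_dir F q a1 b1) / 6 <= slope F q a1 b1).
  { replace (/ (3 * al)) with (2 / al / 6) in Hslope by (field; lra); lra. }
  nra. }
destruct (choose_sign q (- b1) a1 ltac:(lra)) as [a2 [b2 [H2 [Hs2 Hc2]]]].
rewrite <- Hc2 in Hcurv2.
(* The point q is at distance al/2 < (rho + 1)/2 from c, which leaves room (rho - 1)/2 inside the
   ball. *)
assert (HD2 : forall t, 0 <= t < (rho - 1) / 2 -> D (geo q a2 b2 H2 t)).
{ intros t Ht2; apply Hball.
  assert (Htr := hdist_triangle c q (geo q a2 b2 H2 t)).
  unfold q in Htr at 2; rewrite !hdist_geo in Htr by lra; lra. }
assert (Hbeta : 0 < / sqrt (hess_dir F q a2 b2) < 5).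
{ assert (Hq := sqrt_lt_R0 _ (hess_dir_pos q a2 b2 Dq H2)).
  split; [now apply Rinv_0_lt_compat|].
  rewrite <- (Rinv_inv 5); apply Rinv_lt_contravar; [lra|].
  rewrite <- (sqrt_pow2 (/ 5)) by lra; apply sqrt_lt_1_alt; lra. }
set (be := / sqrt (hess_dir F q a2 b2)) in *.
set (g := fun s => slope F (geo q a2 b2 H2 s) (geo_a a2 b2 s) (geo_b b2 s)).
(* The gain 1/be - 1/(be + 5) decreases in be, and equals 1/10 at be = 5; here be <= sqrt 24 < 5. *)
assert (Hg5 : / 10 <= g 5).
{ assert (Hg := gradient_growth _ _ _ _
    (fun t Ht => is_derive_geo_2 q a2 b2 H2 t (HD2 t Ht))
    (fun t Ht => is_derive_geo_3 q a2 b2 H2 t (HD2 t Ht))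
    (fun t Ht => hess_dir_pos _ _ _ (HD2 t Ht) (geo_ab_unit a2 b2 t H2))
    (fun t Ht => third_frame_le _ (geo_a a2 b2 t) (geo_b b2 t) (HD2 t Ht))
    5 ltac:(lra)).
  cbv beta in Hg; rewrite geo_0, geo_a_0, geo_b_0 in Hg; fold be in Hg.
  fold (g 5) in Hg.
  assert (/ 10 <= / be - / (be + 5)); [|lra].
  replace (/ be - / (be + 5)) with (/ (be * (be + 5) / 5)) by (field; lra).
  apply Rinv_le_contravar; nra. }
(* Blow-up is measured from time 5 to one unit before the end of the available room: the elapsed
   time (rho - 13)/2 with slope at least 1/10 yields rho - 13 <= 20 theta. *)
assert (Hbu := blow_up_time g _ _
    (fun t Ht => is_derive_geo_2 q a2 b2 H2 t (HD2 t Ht))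
    (fun t Ht => hess_dir_pos _ _ _ (HD2 t Ht) (geo_ab_unit a2 b2 t H2))
    theta 5 ((rho - 1) / 2 - 1) (proj1 F_barrier)
    (fun t Ht => slope_sqr_le _ _ _ (HD2 t Ht) (geo_ab_unit a2 b2 t H2))
    ltac:(lra) ltac:(lra) ltac:(lra)).
nra.
Qed.

End Barrier.

(** * Largest balls and the final estimate *)

Lemma open_horo_convex_open (D : H2 -> Prop) : open_horo_convex D -> open D.
Proof.
intros [A [_ HA]] p Dp; apply HA, locally_locally in Dp.
revert Dp; apply filter_imp; intros q Hq; now apply HA.
Qed.

Theorem corollary1p6 (D : H2 -> Prop) (r theta : R) (F : H2 -> R)
  (D_horo : open_horo_convex D)
  (D_proper : exists q, ~ D q)
  (r_pos : 0 < r)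
  (D_ball : exists c : H2, forall p : H2, ball c r p -> D p)
  (F_barrier : barrier theta D F) :
  theta >= 1 / 2 ^ 9 * sqrt r - 1 / 8.
Proof.
assert (Hth := proj1 F_barrier).
(* Since sqrt 4096 = 64 and 64 / 2^9 = 1/8, smaller radii make the right side nonpositive. *)
destruct (Rle_lt_dec r 4096) as [Hr | Hr].
{ assert (sqrt r <= 64); [|lra].
  rewrite <- (sqrt_pow2 64) by lra; apply sqrt_le_1_alt; lra. }
destruct D_proper as [q Nq], D_ball as [c Hc].
(* The missing point q bounds the radii of balls around c inside [D]. As balls are open, the
   supremum is itself such a radius, while radius rho + 1 already fails. *)
destruct (completeness (fun rho => forall p, hdist c p < rho -> D p)) as [rho [Hub Hlub]].
{ exists (hdist c q); intros s Hs; apply Rnot_lt_le; intros Hlt; now apply Nq, Hs. }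
{ exists r; exact Hc. }
assert (Hrho : r <= rho) by (apply Hub; exact Hc).
assert (Hball : forall p, hdist c p < rho -> D p).
{ intros p Hp; apply NNPP; intros Np.
  assert (rho <= hdist c p); [|lra].
  apply Hlub; intros s Hs; apply Rnot_lt_le; intros Hlt; now apply Np, Hs. }
assert (Hex : exists p, hdist c p < rho + 1 /\ ~ D p).
{ apply NNPP; intros Hn; assert (rho + 1 <= rho); [|lra].
  apply Hub; intros p Hp; apply NNPP; intros Np; apply Hn; now exists p. }
destruct Hex as [p [Hp Np]].
assert (H := ball_bound D F theta (open_horo_convex_open D D_horo) F_barrier
  c p rho ltac:(lra) Hball Np Hp).
(* With sqrt r replaced by r it remains to compare (r - 13)/20 with r/512 - 1/8 for r > 4096. *)
assert (sqrt r < r) by (apply sqrt_less; lra).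
lra.
Qed.
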